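(* Let $\alpha\vDash n$ and let $\sigma$ be a permutation of $\{1,\dots,\ell(\alpha)\}$. For $\mathrm{StdTab}(D)$ equal to, respectively, $\mathsf{SRCT}^\sigma(\alpha)$, $\mathsf{SYRT}^\sigma(\alpha)$, $\mathsf{SYCT}^\sigma(\alpha)$, the known $H_n(0)$-module on the $\mathbb{C}$-span of $\mathrm{StdTab}(D)$ (defined, respectively, by Tewari and van Willigenburg; by Jung, Kim, Lee and Oh; and by Choi, Kim, Nam and Oh) is precisely the diagram module $\widehat{\mathbf{N}}_{\mathrm{StdTab}(D)}$.
   Context: Generators. $H_n(0)$ is here presented by generators $\hat\pi_1,\dots,\hat\pi_{n-1}$ with relations $\hat\pi_i^2=\hat\pi_i$, $\hat\pi_i\hat\pi_j=\hat\pi_j\hat\pi_i$ for $|i-j|\ge2$, $\hat\pi_i\hat\pi_{i+1}\hat\pi_i=\hat\pi_{i+1}\hat\pi_i\hat\pi_{i+1}$. $\ell(\alpha)$ is the number of parts of $\alpha$. Diagram modules. Let $D$ be a diagram of $n$ boxes with a reading order (a total order on the boxes). A standard filling is a bijective assignment of $1,\dots,n$ to the boxes; $\mathrm{rw}(T)$ is the permutation given by the entries of $T$ in reading order from left to right; $s_iT$ exchanges the entries $i,i+1$ of $T$. For a set $\mathrm{StdTab}(D)$ of standard fillings and $T\in\mathrm{StdTab}(D)$, $\mathrm{Des}(T)$ is the set of $i\in\{1,\dots,n-1\}$ with $i$ to the right of $i+1$ in $\mathrm{rw}(T)$; its elements are descents. A descent $i$ of $T$ is nonattacking if $s_iT\in\mathrm{StdTab}(D)$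 and attacking otherwise. $T$ has a descent in positions $(r,s)$ if $r<s$ and $\mathrm{rw}(T)_r-\mathrm{rw}(T)_s=1$. $\mathrm{StdTab}(D)$ is descent-compatible if whenever $T,T'\in\mathrm{StdTab}(D)$ both have a descent in positions $(r,s)$, it is attacking in $T$ if and only if it is attacking in $T'$. In that case $\widehat{\mathbf{N}}_{\mathrm{StdTab}(D)}$ is the $H_n(0)$-module on the $\mathbb{C}$-span of $\mathrm{StdTab}(D)$ with $\hat\pi_iT=T$ if $i\notin\mathrm{Des}(T)$, $\hat\pi_iT=0$ if $i$ is an attacking descent, $\hat\pi_iT=s_iT$ if $i$ is a nonattacking descent. Tableaux. $D(\alpha)$ is the left-justified array with $\alpha_i$ boxes in row $i$, rows numbered from bottom to top; $T(c,r)$ is the entry in column $c$, row $r$. In each family below, the entries of the first column of $T$, read from bottom to top, are required to be in the same relative order as $\sigma$, i.e. $T(1,j)<T(1,k)$ iff $\sigma(j)<\sigma(k)$. $\mathsf{SRCT}^\sigma(\alpha)$: standard fillings with this first-column condition, entries decreasing from left to right in each row, and: if $(c,r)$ and $(c+1,r')$ with $r<r'$ are in $D(\alpha)$ and $T(c,r)>T(c+1,r')$, then $(c+1,r)\in D(\alpha)$ and $T(c+1,r)>T(c+1,r')$. Reading order: columns from bottom to top, starting at the rightmost column and proceeding leftwards, except that the first column is read last, its boxes being read in the reverse order to $\sigma$ (i.e. so that its entries are read in decreasing order). $\mathsf{SYRT}^\sigma(\alpha)$ and $\mathsf{SYCT}^\sigma(\alpha)$: the same set of standard fillings, with this first-column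 condition, entries increasing from left to right in each row, and: if $(c,r)$ and $(c+1,r')$ with $r'<r$ are in $D(\alpha)$ and $T(c,r)<T(c+1,r')$, then $(c+1,r)\in D(\alpha)$ and $T(c+1,r)<T(c+1,r')$. Reading order for $\mathsf{SYRT}^\sigma(\alpha)$: columns from top to bottom, starting at the rightmost column and proceeding leftwards, except that the first column is read last, its boxes being read in the order of $\sigma$ (i.e. so that its entries are read in increasing order). Reading order for $\mathsf{SYCT}^\sigma(\alpha)$: the first column is read first, in the reverse order to $\sigma$ (entries in decreasing order), and then subsequent columns from bottom to top, in order from left to right. Known modules (on the $\mathbb{C}$-span of the tableaux): - $\mathsf{SRCT}^\sigma(\alpha)$: $\hat\pi_iT=T$ if $i+1$ is strictly left of $i$; $0$ if $i,i+1$ are in the same column, or $i+1$ is strictly above $i$ in the column immediately right of $i$; $s_iT$ otherwise. - $\mathsf{SYRT}^\sigma(\alpha)$: $\hat\pi_iT=T$ if $i+1$ is weakly left of $i$; $0$ if $i+1$ is immediately right of $i$ (same row, adjacent column); $s_iT$ otherwise. - $\mathsf{SYCT}^\sigma(\alpha)$: $\hat\pi_iT=T$ if $i+1$ is strictly right of $i$; $0$ if $i,i+1$ are in the same column, or $i+1$ is strictly above $i$ in the column immediately left of $i$; $s_iT$ otherwise. (When a family is empty the modules are zero.) *)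

(* Defs.v *)
From HB Require Import structures.
From mathcomp Require Import all_boot all_order all_algebra all_fingroup.
From mathcomp Require Import zify.
From mathcomp Require Import complex reals.

Set Implicit Arguments.
Unset Strict Implicit.
Unset Printing Implicit Defensive.

Import GRing.Theory.

(* Throughout, indices are shifted by one: the entries 1, ..., n are the
   elements 0, ..., n-1 of 'I_n, and the generators pi_1, ..., pi_{n-1} are
   indexed by 'I_n.-1, so that i : 'I_n.-1 compares the entries i and i + 1. *)

Lemma succ_entry_proof n (i : 'I_n.-1) : i.+1 < n.
Proof. by rewrite -ltn_predRL. Qed.

Definition entry n (i : 'I_n.-1) : 'I_n := widen_ord (leq_pred n) i.
Definition succ_entry n (i : 'I_n.-1) : 'I_n := Ordinal (succ_entry_proof i).

(* A module over the algebra presented by the 0-Hecke generators and relations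
   is a vector space with endomorphisms pi_i satisfying these relations. Here
   the space is a subspace U of V, and only the restrictions of the pi_i to U
   are relevant. *)
Record is_H0_module (F : fieldType) (V : vectType F) (n : nat)
    (U : {vspace V}) (pi : 'I_n.-1 -> V -> V) : Prop := {
  H0_linear : forall i, linear (pi i);
  H0_stable : forall i v, v \in U -> pi i v \in U;
  H0_idem : forall i v, v \in U -> pi i (pi i v) = pi i v;
  H0_comm : forall (i j : 'I_n.-1) v, i.+1 < j -> v \in U ->
    pi i (pi j v) = pi j (pi i v);
  H0_braid : forall (i j : 'I_n.-1) v, j = i.+1 :> nat -> v \in U ->
    pi i (pi j (pi i v)) = pi j (pi i (pi j v))
}.

Record diagram (n : nat) := Diagram {
  box : finType;
  (* [before x y]: the box x is read strictly before the box y *)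
  before : rel box;
  card_box : #|box| = n;
  before_irr : irreflexive before;
  before_trans : transitive before;
  before_total : forall x y, x != y -> before x y || before y x
}.

Notation filling n B := {ffun B -> 'I_n}.

Definition standard n (B : finType) (T : filling n B) : bool :=
  injectiveb T && [forall k, k \in codom T].

Definition swap n (B : finType) (i : 'I_n.-1) (T : filling n B) : filling n B :=
  [ffun b => tperm (entry i) (succ_entry i) (T b)].

Section DiagramModule.

Variables (n : nat) (D : diagram n).
Implicit Types (S : {set filling n (box D)}) (T : filling n (box D)).

Definition reading_word T : seq 'I_n :=
  [seq T b | b <- sort (fun x y => (x == y) || before x y) (enum (box D))].

Definition is_descent T (i : 'I_n.-1) : bool :=
  index (succ_entry i) (reading_word T) < index (entry i) (reading_word T).

Definition attacking S T (i : 'I_n.-1) : bool := swap i T \notin S.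

(* i is the entry in position s of the reading word *)
Definition descent_in_positions T (r s : nat) (i : 'I_n.-1) : bool :=
  [&& r < s, s < n,
      nth (entry i) (reading_word T) r == succ_entry i
    & nth (succ_entry i) (reading_word T) s == entry i].

Definition descent_compatible S : Prop :=
  forall T T' r s i i', T \in S -> T' \in S ->
    descent_in_positions T r s i -> descent_in_positions T' r s i' ->
    attacking S T i = attacking S T' i'.

End DiagramModule.

Section FillingSpace.

Local Open Scope ring_scope.

Variables (R : realType) (n : nat) (B : finType).

Definition filling_space : vectType R[i] := {ffun filling n B -> (R[i])^o}.

Definition basis_vector (T : filling n B) : filling_space :=
  [ffun U => (U == T)%:R].

Definition tab_span (S : {set filling n B}) : {vspace filling_space} :=
  (<<[seq basis_vector T | T <- enum S]>>)%VS.

Definition linear_extension (f : filling n B -> filling_space)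
    (v : filling_space) : filling_space :=
  \sum_(T : filling n B) v T *: f T.

End FillingSpace.

Arguments basis_vector R {n B} T.
Arguments tab_span R {n B} S.

Definition diagram_action (R : realType) (n : nat) (D : diagram n)
    (S : {set filling n (box D)}) (i : 'I_n.-1) :
    filling_space R n (box D) -> filling_space R n (box D) :=
  linear_extension (fun T =>
    if ~~ is_descent T i then basis_vector R T
    else if attacking S T i then 0%R
    else basis_vector R (swap i T)).

Record composition (n : nat) := Composition {
  parts :> seq nat;
  parts_gt0 : all (leq 1) parts;
  sumn_parts : sumn parts = n
}.

(* The box in row r and column c, both counted from 0 (row 0 at the bottom). *)
Definition comp_box n (al : composition n) : finType :=
  {r : 'I_(size al) & 'I_(nth 0 al r)}.

Definition box_row n (al : composition n) (x : comp_box al) : 'I_(size al) := tag x.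
Definition box_col n (al : composition n) (x : comp_box al) : nat := tagged x.

Section Tableaux.

Variables (n : nat) (al : composition n) (sigma : 'S_(size al)).
Implicit Types (T : filling n (comp_box al)) (x y z : comp_box al).

Definition first_column T : bool :=
  [forall x, forall y, (box_col x == 0) && (box_col y == 0) ==>
     ((T x < T y) == (sigma (box_row x) < sigma (box_row y)))].

Definition SRCT : {set filling n (comp_box al)} :=
  [set T | [&& standard T, first_column T,
    [forall x, forall y, (box_row x == box_row y) && (box_col x < box_col y) ==> (T y < T x)]
  & [forall x, forall y,
      [&& box_col y == (box_col x).+1, box_row x < box_row y & T y < T x] ==>
      [exists z, [&& box_row z == box_row x, box_col z == (box_col x).+1 & T y < T z]]]]].

Definition SYRT : {set filling n (comp_box al)} :=
  [set T | [&& standard T, first_column T,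
    [forall x, forall y, (box_row x == box_row y) && (box_col x < box_col y) ==> (T x < T y)]
  & [forall x, forall y,
      [&& box_col y == (box_col x).+1, box_row y < box_row x & T x < T y] ==>
      [exists z, [&& box_row z == box_row x, box_col z == (box_col x).+1 & T z < T y]]]]].

Definition SYCT : {set filling n (comp_box al)} := SYRT.

Definition SRCT_before : rel (comp_box al) := fun x y =>
  if box_col x == 0 then (box_col y == 0) && (sigma (box_row y) < sigma (box_row x))
  else [|| box_col y == 0, box_col y < box_col x | (box_col y == box_col x) && (box_row x < box_row y)].

Definition SYRT_before : rel (comp_box al) := fun x y =>
  if box_col x == 0 then (box_col y == 0) && (sigma (box_row x) < sigma (box_row y))
  else [|| box_col y == 0, box_col y < box_col x | (box_col y == box_col x) && (box_row y < box_row x)].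

Definition SYCT_before : rel (comp_box al) := fun x y =>
  if box_col x == 0 then (0 < box_col y) || (sigma (box_row y) < sigma (box_row x))
  else (box_col x < box_col y) || (box_col y == box_col x) && (box_row x < box_row y).

Lemma card_comp_box : #|comp_box al| = n.
Proof.
rewrite card_tagged -[RHS](sumn_parts al); congr sumn.
apply: (@eq_from_nth _ 0); first by rewrite size_map size_enum_ord.
move=> k; rewrite size_map => Hk; have Hk' := Hk; rewrite size_enum_ord in Hk'.
by rewrite (nth_map (Ordinal Hk')) // card_ord nth_enum_ord.
Qed.

Lemma box_eq x y : box_row x = box_row y :> nat -> box_col x = box_col y -> x = y.
Proof.
case: x y => [r c] [r' c']; rewrite /box_row /box_col /= => /val_inj Er.
by case: r' / Er c' => c' /val_inj ->.
Qed.

Lemma sigma_eq (r s : 'I_(size al)) : (r == s :> nat) = (sigma r == sigma s :> nat).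
Proof. by rewrite !(inj_eq val_inj) (inj_eq perm_inj). Qed.

Lemma before_totalP (lt : rel (comp_box al)) :
  (forall x y, box_col x != box_col y -> lt x y || lt y x) ->
  (forall x y, box_col x = box_col y -> box_row x != box_row y :> nat -> lt x y || lt y x) ->
  forall x y, x != y -> lt x y || lt y x.
Proof.
move=> Hc Hr x y nxy; have [Ec|] := eqVneq (box_col x) (box_col y); last exact: Hc.
by apply: Hr => //; apply: contraNneq nxy => Er; apply/eqP/box_eq.
Qed.

Lemma SRCT_irr : irreflexive SRCT_before.
Proof. by move=> x; rewrite /SRCT_before; case: ifP; lia. Qed.
Lemma SRCT_trans : transitive SRCT_before.
Proof. by move=> y x z; rewrite /SRCT_before; do !case: ifP; lia. Qed.
Lemma SRCT_total x y : x != y -> SRCT_before x y || SRCT_before y x.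
Proof.
apply: before_totalP x y => x y; rewrite /SRCT_before;
  have := sigma_eq (box_row x) (box_row y); do !case: ifP; lia.
Qed.

Lemma SYRT_irr : irreflexive SYRT_before.
Proof. by move=> x; rewrite /SYRT_before; case: ifP; lia. Qed.
Lemma SYRT_trans : transitive SYRT_before.
Proof. by move=> y x z; rewrite /SYRT_before; do !case: ifP; lia. Qed.
Lemma SYRT_total x y : x != y -> SYRT_before x y || SYRT_before y x.
Proof.
apply: before_totalP x y => x y; rewrite /SYRT_before;
  have := sigma_eq (box_row x) (box_row y); do !case: ifP; lia.
Qed.

Lemma SYCT_irr : irreflexive SYCT_before.
Proof. by move=> x; rewrite /SYCT_before; case: ifP; lia. Qed.
Lemma SYCT_trans : transitive SYCT_before.
Proof. by move=> y x z; rewrite /SYCT_before; do !case: ifP; lia. Qed.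
Lemma SYCT_total x y : x != y -> SYCT_before x y || SYCT_before y x.
Proof.
apply: before_totalP x y => x y; rewrite /SYCT_before;
  have := sigma_eq (box_row x) (box_row y); do !case: ifP; lia.
Qed.

Definition SRCT_diagram : diagram n :=
  Diagram card_comp_box SRCT_irr SRCT_trans SRCT_total.
Definition SYRT_diagram : diagram n :=
  Diagram card_comp_box SYRT_irr SYRT_trans SYRT_total.
Definition SYCT_diagram : diagram n :=
  Diagram card_comp_box SYCT_irr SYCT_trans SYCT_total.

(* P holds of the box containing i and the box containing i + 1 *)
Definition boxes_of T (i : 'I_n.-1) (P : rel (comp_box al)) : bool :=
  [exists x, exists y, [&& T x == entry i, T y == succ_entry i & P x y]].

Variable R : realType.

Let V := filling_space R n (comp_box al).

Definition SRCT_action (i : 'I_n.-1) : V -> V := linear_extension (fun T =>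
  if boxes_of T i (fun x y => box_col y < box_col x) then basis_vector R T
  else if boxes_of T i (fun x y =>
    (box_col x == box_col y) || (box_col y == (box_col x).+1) && (box_row x < box_row y)) then 0%R
  else basis_vector R (swap i T)).

Definition SYRT_action (i : 'I_n.-1) : V -> V := linear_extension (fun T =>
  if boxes_of T i (fun x y => box_col y <= box_col x) then basis_vector R T
  else if boxes_of T i (fun x y =>
    (box_col y == (box_col x).+1) && (box_row x == box_row y)) then 0%R
  else basis_vector R (swap i T)).

Definition SYCT_action (i : 'I_n.-1) : V -> V := linear_extension (fun T =>
  if boxes_of T i (fun x y => box_col x < box_col y) then basis_vector R T
  else if boxes_of T i (fun x y =>
    (box_col x == box_col y) || (box_col x == (box_col y).+1) && (box_row x < box_row y)) then 0%R
  else basis_vector R (swap i T)).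

End Tableaux.

Arguments SRCT_action {n} al R i _.
Arguments SYRT_action {n} al R i _.
Arguments SYCT_action {n} al R i _.

(* Main.v *)
Require Import Defs.
From HB Require Import structures.
From mathcomp Require Import all_boot all_order all_algebra all_fingroup.
From mathcomp Require Import zify.
From mathcomp Require Import complex reals.

Set Implicit Arguments.
Unset Strict Implicit.
Unset Printing Implicit Defensive.

Import GRing.Theory.

(** In each of the three families, whether pi_i fixes, kills or swaps a tableau
    depends only on the pair of boxes holding i and i + 1, through two relations
    P ("fix") and Q ("kill").  The 0-Hecke relations for any such action, on all
    standard fillings at once, need only that P is negatively transitive and
    that any two boxes are comparable for P or related by Q: the braid relation
    compares two words in the three boxes holding i, i + 1, i + 2, and each is
    nonzero exactly when the same pairs of boxes avoid Q.  It remains to see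
    that on tableaux P is the reading order and Q the attacking condition.  The
    triple condition forces i + 1 to be below i when both lie in a common
    column other than the first, and forbids the swap exactly for the adjacent
    columns listed in the definition of the actions. *)

(** * Exchanging two consecutive entries of a filling *)

Section Swap.

Variables (n : nat) (B : finType).
Implicit Types (T : filling n B) (i j : 'I_n.-1) (b u v x y z : B).

Lemma standard_inj T : standard T -> injective T.
Proof. by case/andP=> /injectiveP. Qed.

Lemma standard_ex T k : standard T -> exists x, T x = k.
Proof. by case/andP=> _ /forallP/(_ k)/codomP[x ->]; exists x. Qed.

Lemma entry_neq i : entry i != succ_entry i.
Proof. by rewrite -val_eqE /= neq_ltn ltnSn. Qed.

Lemma swap_inj i T : injective T -> injective (swap i T).
Proof. by move=> T_inj u v; rewrite !ffunE => /perm_inj/T_inj. Qed.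

Lemma swap_standard i T : standard T -> standard (swap i T).
Proof.
move=> T_std; apply/andP; split.
  exact/injectiveP/swap_inj/standard_inj.
apply/forallP=> k.
have [x Tx] := standard_ex (tperm (entry i) (succ_entry i) k) T_std.
by apply/codomP; exists x; rewrite ffunE Tx tpermK.
Qed.

Lemma swap_entry i T x : T x = entry i -> swap i T x = succ_entry i.
Proof. by rewrite ffunE => ->; rewrite tpermL. Qed.

Lemma swap_succ_entry i T y : T y = succ_entry i -> swap i T y = entry i.
Proof. by rewrite ffunE => ->; rewrite tpermR. Qed.

Lemma swap_val i T b : swap i T b =
  (if T b == i :> nat then i.+1 else if T b == i.+1 :> nat then nat_of_ord i else T b)
  :> nat.
Proof.
rewrite ffunE; case: tpermP => [->|->|/eqP + /eqP]; rewrite -?val_eqE /= ?eqxx //.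
  by rewrite gtn_eqF.
by move=> /negPf-> /negPf->.
Qed.

Lemma swap_other i T z :
  T z != entry i -> T z != succ_entry i -> swap i T z = T z.
Proof. by rewrite ffunE => ? ?; rewrite tpermD // eq_sym. Qed.

Lemma swapC i j T : i.+1 < j -> swap i (swap j T) = swap j (swap i T).
Proof.
move=> lij; apply/ffunP=> b; apply/val_inj; rewrite /= !swap_val.
by do !case: eqP; lia.
Qed.

Lemma swap_braid i j T : j = i.+1 :> nat ->
  swap i (swap j (swap i T)) = swap j (swap i (swap j T)).
Proof.
by move=> Ej; apply/ffunP=> b; apply/val_inj; rewrite /= !swap_val; do !case: eqP; lia.
Qed.

(** No value lies strictly between [i] and [i + 1], so exchanging them can only affect the
    comparison of the two boxes that hold them. *)
Lemma swap_ltE i T x y u v : injective T ->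
    T x = entry i -> T y = succ_entry i ->
    (u, v) != (x, y) -> (u, v) != (y, x) ->
  (swap i T u < swap i T v) = (T u < T v).
Proof.
move=> T_inj Tx Ty; rewrite !xpair_eqE -!(inj_eq T_inj) Tx Ty -!val_eqE /=.
rewrite !swap_val; do !case: eqP; lia.
Qed.

End Swap.

(** * Linear maps on the span of a set of tableaux *)

Section LinearExtension.

Local Open Scope ring_scope.
Variables (R : realType) (n : nat) (B : finType).
Let V := filling_space R n B.
Implicit Types (f g : filling n B -> V) (S : {set filling n B}).

Fact linear_extension_is_linear f : linear (linear_extension f).
Proof.
move=> a u v; rewrite /linear_extension scaler_sumr -big_split /=.
by apply: eq_bigr => T _; rewrite !ffunE scalerDl scalerA.
Qed.

HB.instance Definition _ f := GRing.isLinear.Build R[i] V V _ (linear_extension f)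
  (linear_extension_is_linear f).

Lemma linear_extension_basis f T : linear_extension f (basis_vector R T) = f T.
Proof.
rewrite /linear_extension (bigD1 T) //= big1 => [|U nUT].
  by rewrite ffunE eqxx scale1r addr0.
by rewrite ffunE (negPf nUT) scale0r.
Qed.

(** Reduces the 0-Hecke relations, and the equality of two actions, to identities on single
    tableaux. *)
Lemma eq_on_tab_span (phi psi : {linear V -> V}) S :
  {in S, forall T, phi (basis_vector R T) = psi (basis_vector R T)} ->
  {in tab_span R S, phi =1 psi}.
Proof.
move=> eq_phi; have /span_lfunP eq_span :
    {in [seq basis_vector R T | T <- enum S], linfun phi =1 linfun psi}.
  move=> _ /mapP[T + ->]; rewrite mem_enum !lfunE; exact: eq_phi.
by move=> v /eq_span; rewrite !lfunE.
Qed.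

Lemma basis_vector_span S T : T \in S -> basis_vector R T \in tab_span R S.
Proof. by move=> ST; apply/memv_span/map_f; rewrite mem_enum. Qed.

Lemma tab_span_stable (phi : {linear V -> V}) S :
  {in S, forall T, phi (basis_vector R T) \in tab_span R S} ->
  {in tab_span R S, forall v, phi v \in tab_span R S}.
Proof.
move=> phiS; have sub : (linfun phi @: tab_span R S <= tab_span R S)%VS.
  rewrite limg_span; apply/span_subvP=> _ /mapP[_ /mapP[T + ->] ->].
  by rewrite mem_enum lfunE; apply: phiS.
by move=> v /(memv_img (linfun phi)); rewrite lfunE; move/(subvP sub).
Qed.

End LinearExtension.

Lemma boxes_ofE n (al : composition n) (P : rel (comp_box al))
    (T : filling n (comp_box al)) i x y :
  injective T -> T x = entry i -> T y = succ_entry i -> boxes_of T i P = P x y.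
Proof.
move=> T_inj Tx Ty; apply/existsP/idP => [[u /existsP[v]]|Pxy].
  by rewrite -Tx -Ty !(inj_eq T_inj) => /and3P[/eqP-> /eqP->].
by exists x; apply/existsP; exists y; rewrite Tx Ty !eqxx.
Qed.

(** * The 0-Hecke relations for actions decided by the boxes of [i] and [i + 1] *)

Section PositionalAction.

Local Open Scope ring_scope.

Variables (R : realType) (n : nat) (al : composition n) (P Q : rel (comp_box al)).
Implicit Types (T : filling n (comp_box al)) (i j : 'I_n.-1) (x y z : comp_box al).

(** Each of the three known actions unfolds to this one for its own [P] and [Q], where [P] is a
    strict or weak comparison of columns; such comparisons are negatively transitive. *)
Definition positional_action i :=
  linear_extension (fun T =>
    if boxes_of T i P then basis_vector R T
    else if boxes_of T i Q then 0%R
    else basis_vector R (swap i T)).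

Lemma positional_actionE T i x y :
    standard T -> T x = entry i -> T y = succ_entry i ->
  positional_action i (basis_vector R T) =
    if P x y then basis_vector R T
    else if Q x y then 0 else basis_vector R (swap i T).
Proof.
move=> /standard_inj T_inj Tx Ty; rewrite /positional_action linear_extension_basis.
by rewrite !(boxes_ofE _ T_inj Tx Ty).
Qed.

Lemma positional_action0 i : positional_action i 0 = 0.
Proof. exact: linear0. Qed.

Hypothesis P_negtrans : forall y x z, P x z -> P x y || P y z.
Hypothesis PQ_total : forall x y, [|| P x y, P y x | Q x y].

(** If [T] is swapped, neither [P x y] nor [Q x y] holds, so totality gives [P y x]. The swapped
    tableau has [i] in [y] and [i + 1] in [x], hence is fixed. *)
Lemma positional_action_idem T i : standard T ->
  positional_action i (positional_action i (basis_vector R T)) =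
  positional_action i (basis_vector R T).
Proof.
move=> T_std; have [x Tx] := standard_ex (entry i) T_std.
have [y Ty] := standard_ex (succ_entry i) T_std.
rewrite (positional_actionE T_std Tx Ty); case: ifP => [Pxy|nPxy].
  by rewrite (positional_actionE T_std Tx Ty) Pxy.
case: ifP => [_|nQxy]; first exact: positional_action0.
rewrite (positional_actionE (swap_standard i T_std) (swap_succ_entry Ty) (swap_entry Tx)).
by have := PQ_total x y; rewrite nPxy nQxy orbF /= => ->.
Qed.

(** The entries moved by one generator are disjoint from those tested by the other, so the outcome
    of each test does not depend on the order. *)
Lemma positional_action_comm T i j : (i.+1 < j)%N -> standard T ->
  positional_action i (positional_action j (basis_vector R T)) =
  positional_action j (positional_action i (basis_vector R T)).
Proof.
move=> lij T_std; have [x Tx] := standard_ex (entry i) T_std.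
have [y Ty] := standard_ex (succ_entry i) T_std.
have [z Tz] := standard_ex (entry j) T_std.
have [t Tt] := standard_ex (succ_entry j) T_std.
have Tx' : swap j T x = entry i by rewrite swap_other // Tx -val_eqE /=; lia.
have Ty' : swap j T y = succ_entry i by rewrite swap_other // Ty -val_eqE /=; lia.
have Tz' : swap i T z = entry j by rewrite swap_other // Tz -val_eqE /=; lia.
have Tt' : swap i T t = succ_entry j by rewrite swap_other // Tt -val_eqE /=; lia.
have Ei := positional_actionE T_std Tx Ty.
have Ej := positional_actionE T_std Tz Tt.
have Ei' := positional_actionE (swap_standard j T_std) Tx' Ty'.
have Ej' := positional_actionE (swap_standard i T_std) Tz' Tt'.
rewrite Ei Ej; case Pxy: (P x y); case Qxy: (Q x y); case Pzt: (P z t); case Qzt: (Q z t);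
  rewrite ?positional_action0 ?Ei ?Ej ?Ei' ?Ej' ?Pxy ?Qxy ?Pzt ?Qzt;
  rewrite ?positional_action0 //.
by rewrite swapC.
Qed.

Lemma positional_action_braid T i j : j = i.+1 :> nat -> standard T ->
  positional_action i (positional_action j (positional_action i (basis_vector R T))) =
  positional_action j (positional_action i (positional_action j (basis_vector R T))).
Proof.
(* [tri U x y z] says that [i], [i + 1], [i + 2] occupy [x], [y], [z]: here [succ_entry j] is
   [i + 2], and [entry j] is [succ_entry i]. The swaps then merely permute the three boxes. *)
move=> Ej T_std; pose tri U x y z :=
  [/\ standard U, U x = entry i, U y = succ_entry i & U z = succ_entry j].
have Eij : succ_entry i = entry j by exact/val_inj.
have Ei U x y z : tri U x y z -> positional_action i (basis_vector R U) =
    if P x y then basis_vector R U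
    else if Q x y then 0 else basis_vector R (swap i U).
  by case=> U_std Ux Uy _; exact: positional_actionE.
have Ej' U x y z : tri U x y z -> positional_action j (basis_vector R U) =
    if P y z then basis_vector R U
    else if Q y z then 0 else basis_vector R (swap j U).
  by case=> U_std _ Uy Uz; apply: positional_actionE; rewrite -?Eij.
have tri_i U x y z : tri U x y z -> tri (swap i U) y x z.
  case=> U_std Ux Uy Uz; split; rewrite ?swap_standard //.
  - exact: swap_succ_entry.
  - exact: swap_entry.
  - by rewrite swap_other // Uz -val_eqE /=; lia.
have tri_j U x y z : tri U x y z -> tri (swap j U) x z y.
  rewrite /tri Eij => -[U_std Ux Uy Uz]; split; first exact: swap_standard.
  - by rewrite swap_other // Ux -val_eqE /=; lia.
  - exact: swap_succ_entry.
  - exact: swap_entry.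
have [x Tx] := standard_ex (entry i) T_std.
have [y Ty] := standard_ex (succ_entry i) T_std.
have [z Tz] := standard_ex (succ_entry j) T_std.
have t1 : tri T x y z by [].
have [t2 t3] := (tri_i _ _ _ _ t1, tri_j _ _ _ _ t1).
have [t4 t5] := (tri_j _ _ _ _ t2, tri_i _ _ _ _ t3).
(* Once a pair has been swapped, it is fixed when met again in the reverse order. *)
have back a b : P a b = false -> Q a b = false -> P b a.
  by move=> nPab nQab; have := PQ_total a b; rewrite nPab nQab orbF.
have nPxz : P x y = false -> P y z = false -> P x z = false.
  by move=> nPxy nPyz; apply/negP=> /(P_negtrans y); rewrite nPxy nPyz.
pose E0 := positional_action0.
rewrite (Ei _ _ _ _ t1) (Ej' _ _ _ _ t1).
case Pxy: (P x y); case Pyz: (P y z).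
- by do 2!rewrite (Ei _ _ _ _ t1) (Ej' _ _ _ _ t1) Pxy Pyz.
- rewrite (Ej' _ _ _ _ t1) Pyz; case Qyz: (Q y z); first by rewrite !E0.
  rewrite (Ei _ _ _ _ t3); case: (P x z); first by rewrite (Ej' _ _ _ _ t3) back.
  by case: (Q x z); rewrite ?E0 // (Ej' _ _ _ _ t5) Pxy.
- rewrite (Ei _ _ _ _ t1) Pxy; case Qxy: (Q x y); first by rewrite !E0.
  rewrite (Ej' _ _ _ _ t2); case: (P x z); first by rewrite (Ei _ _ _ _ t2) back.
  by case: (Q x z); rewrite ?E0 // (Ei _ _ _ _ t4) Pyz.
(* When neither pair is fixed, both words test the pairs [x y], [x z], [y z], in opposite orders,
   and [P] fails on all three. Each word vanishes as soon as one of them satisfies [Q]; otherwise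
   all three swaps are performed and [swap_braid] applies. *)
have nPxz' := nPxz Pxy Pyz.
case Qxy: (Q x y); case Qyz: (Q y z).
- by rewrite !E0.
- rewrite !E0 (Ei _ _ _ _ t3) nPxz'; case: (Q x z); first by rewrite E0.
  by rewrite (Ej' _ _ _ _ t5) Pxy Qxy.
- rewrite !E0 (Ej' _ _ _ _ t2) nPxz'; case: (Q x z); first by rewrite E0.
  by rewrite (Ei _ _ _ _ t4) Pyz Qyz.
rewrite (Ej' _ _ _ _ t2) (Ei _ _ _ _ t3) nPxz'; case: (Q x z); first by rewrite !E0.
by rewrite (Ei _ _ _ _ t4) (Ej' _ _ _ _ t5) Pxy Qxy Pyz Qyz swap_braid.
Qed.

End PositionalAction.

Arguments positional_action R {n al} P Q i _.

(** * Descents of the reading word in terms of the reading order on boxes *)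

Section ReadingWord.

Variables (n : nat) (D : diagram n).
Implicit Types (T : filling n (box D)) (i : 'I_n.-1) (x y : box D).

Let le : rel (box D) := fun x y => (x == y) || before x y.
Let boxes := sort le (enum (box D)).

Let le_total : total le.
Proof.
move=> x y; rewrite /le [y == x]eq_sym.
by case: eqVneq => //= nxy; apply: before_total.
Qed.

Let le_trans : transitive le.
Proof.
move=> y x z; rewrite /le => /predU1P[->//|bxy] /predU1P[<-|byz].
  by rewrite bxy orbT.
by rewrite (before_trans bxy byz) orbT.
Qed.

Let boxes_sorted : sorted le boxes.
Proof. exact: sort_sorted. Qed.

Let mem_boxes x : x \in boxes.
Proof. by rewrite mem_sort mem_enum. Qed.

Lemma before_asym x y : before x y -> before y x = false.
Proof. by move=> bxy; apply/negP=> /(before_trans bxy); rewrite before_irr. Qed.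

(** The list [boxes] is sorted for the reflexive closure [le] of the strict order [before], so
    irreflexivity has to rule out equal boxes in both directions. *)
Lemma index_boxes_lt x y : (index x boxes < index y boxes) = before x y.
Proof.
apply/idP/idP => [lxy|bxy].
  have := sorted_ltn_index le_trans boxes_sorted x y (mem_boxes x) (mem_boxes y) lxy.
  by case/predU1P=> // Exy; move: lxy; rewrite Exy ltnn.
rewrite ltnNge; apply/negP=> lyx.
have le_refl : reflexive le by move=> z; rewrite /le eqxx.
have := sorted_leq_index le_trans le_refl boxes_sorted y x
  (mem_boxes y) (mem_boxes x) lyx.
by case/predU1P=> [Exy|]; [move: bxy; rewrite Exy before_irr | rewrite before_asym].
Qed.

Lemma is_descentE T i x y : injective T -> T x = entry i -> T y = succ_entry i ->
  is_descent T i = before y x.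
Proof.
by rewrite /is_descent => T_inj <- <-; rewrite /reading_word !index_map // index_boxes_lt.
Qed.

Lemma descent_in_positions_boxes T r s i x0 : descent_in_positions T r s i ->
  T (nth x0 boxes s) = entry i /\ T (nth x0 boxes r) = succ_entry i.
Proof.
have size_boxes : size boxes = n by rewrite size_sort -cardE card_box.
case/and4P=> lrs lsn /eqP; rewrite /reading_word -/le -/boxes.
(* Since [r < s < n], both positions are in range and no default value is reached. *)
rewrite (nth_map x0) ?size_boxes ?(ltn_trans lrs) // => Tr /eqP.
by rewrite (nth_map x0) ?size_boxes.
Qed.

Lemma descent_in_positions_before T r s i x0 : descent_in_positions T r s i ->
  before (nth x0 boxes r) (nth x0 boxes s).
Proof.
have size_boxes : size boxes = n by rewrite size_sort -cardE card_box.
have uniq_boxes : uniq boxes by rewrite sort_uniq enum_uniq.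
case/and4P=> lrs lsn _ _; rewrite -index_boxes_lt !index_uniq ?size_boxes //.
exact: ltn_trans lsn.
Qed.

End ReadingWord.

(** * Criterion for a positional action to be a diagram module *)

Section DiagramModule.

Variables (R : realType) (n : nat) (al : composition n) (lt P Q : rel (comp_box al)).
Variables (lt_irr : irreflexive lt) (lt_trans : transitive lt).
Variable lt_total : forall x y, x != y -> lt x y || lt y x.
Let D : diagram n := Diagram (card_comp_box al) lt_irr lt_trans lt_total.
Variable S : {set filling n (comp_box al)}.

Hypothesis S_std : {in S, forall T, standard T}.
Hypothesis P_negtrans : forall y x z, P x z -> P x y || P y z.
Hypothesis PQ_total : forall x y, [|| P x y, P y x | Q x y].
(** The agreement is asked only for boxes holding consecutive entries of a tableau of [S]: on other
    pairs within a column, [P] and the reading order may differ. *)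
Hypothesis P_lt : forall T i x y, T \in S -> T x = entry i -> T y = succ_entry i ->
  P x y = lt x y.
Hypothesis Q_attacking : forall T i x y,
  T \in S -> T x = entry i -> T y = succ_entry i -> lt y x -> (swap i T \notin S) = Q x y.

(** Descents in the same positions of two tableaux occupy the same two boxes, and [Q] on these boxes
    decides whether they attack: this is descent-compatibility. The relations come from those on
    standard fillings, and the two actions have matching cases. *)
Lemma positional_diagram_module :
  [/\ @descent_compatible n D S,
      is_H0_module (tab_span R S) (positional_action R P Q)
    & forall i v, v \in tab_span R S ->
        positional_action R P Q i v = @diagram_action R n D S i v].
Proof.
have lt_asym x y : lt x y -> lt y x = false by exact: (@before_asym n D).
set act := positional_action R P Q.
split.
- move=> T T' r s i i' ST ST' dT dT'.
  (* Any box will do: it only serves as the default of [nth]. *)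
  have [x0 _] := standard_ex (entry i) (S_std ST).
  have [Ti Ti1] := @descent_in_positions_boxes n D T r s i x0 dT.
  have [Ti' Ti1'] := @descent_in_positions_boxes n D T' r s i' x0 dT'.
  have := @descent_in_positions_before n D T r s i x0 dT => lt_rs.
  by rewrite /attacking (Q_attacking ST Ti Ti1) // (Q_attacking ST' Ti' Ti1').
- split.
  + by move=> i; apply: linear_extension_is_linear.
  + move=> i; apply: tab_span_stable => T ST; have T_std := S_std ST.
    have [x Tx] := standard_ex (entry i) T_std.
    have [y Ty] := standard_ex (succ_entry i) T_std.
    rewrite [X in X \in _](positional_actionE R P Q T_std Tx Ty).
    rewrite (P_lt ST Tx Ty); case: ifP => [_|nltxy]; first exact: basis_vector_span.
    have nxy : x != y.
      by apply: contra_neq (entry_neq i) => Exy; rewrite -Tx -Ty Exy.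
    (* Where [P] fails, [i] is a descent, so the failure of [Q] means that the swap stays in [S]. *)
    have ltyx : lt y x by have := lt_total nxy; rewrite nltxy.
    case: ifPn => [_|]; first exact: mem0v.
    rewrite -(Q_attacking ST Tx Ty ltyx) negbK; exact: basis_vector_span.
  + move=> i v; apply: (@eq_on_tab_span R n _ (act i \o act i) (act i)) => T ST.
    exact: positional_action_idem (S_std ST).
  + move=> i j v lij; apply: (@eq_on_tab_span R n _
      (act i \o act j) (act j \o act i)) => T ST.
    exact: positional_action_comm (S_std ST).
  + move=> i j v Ej; apply: (@eq_on_tab_span R n _
      (act i \o (act j \o act i)) (act j \o (act i \o act j))) => T ST.
    exact: positional_action_braid (S_std ST).
move=> i; apply: (@eq_on_tab_span R n _ (act i) (linear_extension _)) => T ST.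
have T_std := S_std ST.
have [x Tx] := standard_ex (entry i) T_std.
have [y Ty] := standard_ex (succ_entry i) T_std.
rewrite [LHS](positional_actionE R P Q T_std Tx Ty) [RHS]linear_extension_basis.
rewrite (@is_descentE n D T i x y (standard_inj T_std) Tx Ty) /= (P_lt ST Tx Ty).
have nxy : x != y by apply: contra_neq (entry_neq i) => Exy; rewrite -Tx -Ty Exy.
case: (boolP (lt y x)) => [ltyx|nltyx] /=.
  by rewrite (lt_asym _ _ ltyx) /attacking (Q_attacking ST Tx Ty ltyx).
by have := lt_total nxy; rewrite (negPf nltyx) orbF => ->.
Qed.

End DiagramModule.

(** * Which swaps leave the set of tableaux *)

Section TableauSwaps.

Variables (n : nat) (al : composition n) (sigma : 'S_(size al)).
Implicit Types (T : filling n (comp_box al)) (i : 'I_n.-1).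
Implicit Types (x y z u v w : comp_box al).

Lemma left_box u c : c <= box_col u -> exists2 w, box_row w = box_row u & box_col w = c.
Proof.
case: u => r k; rewrite /box_row /box_col /= => le_ck.
have ltc := leq_ltn_trans le_ck (ltn_ord k).
by exists (Tagged (fun r : 'I_(size al) => 'I_(nth 0 al r)) (Ordinal ltc)).
Qed.

Lemma first_columnP T :
  reflect (forall x y, box_col x = 0 -> box_col y = 0 ->
     (T x < T y) = (sigma (box_row x) < sigma (box_row y)))
  (first_column sigma T).
Proof.
apply: (iffP forallP) => [fcT x y cx cy | fcT x].
  by have /forallP/(_ y) := fcT x; rewrite cx cy => /eqP.
by apply/forallP=> y; apply/implyP=> /andP[/eqP cx /eqP cy]; rewrite fcT.
Qed.

Lemma SYRTP T :
  reflect [/\ standard T, first_column sigma T,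
    forall x y, box_row x = box_row y -> box_col x < box_col y -> T x < T y
  & forall x y, box_col y = (box_col x).+1 -> box_row y < box_row x -> T x < T y ->
      exists z, [/\ box_row z = box_row x, box_col z = (box_col x).+1 & T z < T y]]
  (T \in SYRT sigma).
Proof.
rewrite inE; apply: (iffP and4P) => -[T_std fcT rowT triT]; split=> //.
- by move=> x y rxy cxy; have /forallP/(_ y) := forallP rowT x; rewrite rxy cxy eqxx.
- move=> x y cxy rxy ltT; have /forallP/(_ y) := forallP triT x.
  rewrite cxy rxy ltT eqxx => /existsP[z /and3P[/eqP rz /eqP cz ltz]].
  by exists z; rewrite cz.
- apply/forallP=> x; apply/forallP=> y; apply/implyP=> /andP[/eqP rxy cxy]; exact: rowT.
- apply/forallP=> x; apply/forallP=> y; apply/implyP=> /and3P[/eqP cxy rxy ltT].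
  have [z [rz cz ltz]] := triT x y cxy rxy ltT.
  by apply/existsP; exists z; rewrite rz cz ltz !eqxx.
Qed.

Lemma SRCTP T :
  reflect [/\ standard T, first_column sigma T,
    forall x y, box_row x = box_row y -> box_col x < box_col y -> T y < T x
  & forall x y, box_col y = (box_col x).+1 -> box_row x < box_row y -> T y < T x ->
      exists z, [/\ box_row z = box_row x, box_col z = (box_col x).+1 & T y < T z]]
  (T \in SRCT sigma).
Proof.
rewrite inE; apply: (iffP and4P) => -[T_std fcT rowT triT]; split=> //.
- by move=> x y rxy cxy; have /forallP/(_ y) := forallP rowT x; rewrite rxy cxy eqxx.
- move=> x y cxy rxy ltT; have /forallP/(_ y) := forallP triT x.
  rewrite cxy rxy ltT eqxx => /existsP[z /and3P[/eqP rz /eqP cz ltz]].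
  by exists z; rewrite cz.
- apply/forallP=> x; apply/forallP=> y; apply/implyP=> /andP[/eqP rxy cxy]; exact: rowT.
- apply/forallP=> x; apply/forallP=> y; apply/implyP=> /and3P[/eqP cxy rxy ltT].
  have [z [rz cz ltz]] := triT x y cxy rxy ltT.
  by apply/existsP; exists z; rewrite rz cz ltz !eqxx.
Qed.

(** Otherwise [v] is above [u]. Its left neighbour [w] has an entry below that of [v], hence below
    that of [u], as [w] is not [u]. The triple condition for [w] and [u] then makes the entry of [v]
    smaller than that of [u]. *)
Lemma SYRT_column T u v : T \in SYRT sigma -> T v = (T u).+1 :> nat ->
  box_col u = box_col v -> 0 < box_col v -> box_row v < box_row u.
Proof.
case/SYRTP=> T_std _ rowT triT Tuv cuv cv; have T_inj := standard_inj T_std.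
rewrite ltnNge; apply/negP=> le_uv.
have lt_uv : box_row u < box_row v.
  rewrite ltn_neqAle le_uv andbT; apply: contra_eqN (Tuv) => /eqP ruv.
  by rewrite (box_eq ruv cuv) neq_ltn ltnSn.
have [w rw cw] := @left_box v (box_col v).-1 (leq_pred _).
have lt_wv : T w < T v by apply: rowT; rewrite // cw; lia.
have nwu : T w != T u.
  by rewrite (inj_eq T_inj); apply: contraTneq cv => Ewu; move: cw; rewrite Ewu; lia.
have cu : box_col u = (box_col w).+1 by lia.
have ru : box_row u < box_row w by rewrite rw.
have lt_wu : T w < T u by rewrite ltn_neqAle val_eqE nwu -ltnS -Tuv.
have [z [rz cz ltz]] := triT w u cu ru lt_wu.
have Ezv : z = v by apply: box_eq; [rewrite rz rw | rewrite cz cw; lia].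
by move: ltz; rewrite Ezv; lia.
Qed.

(** A swap within a row or column breaks the row condition, the first-column condition or
    [SYRT_column]. In every other case only the triple condition can compare [x] with [y], and this
    happens exactly when they lie in adjacent columns with the box in the right one lower. *)
Lemma SYRT_swap T i x y :
    T \in SYRT sigma -> T x = entry i -> T y = succ_entry i ->
  (swap i T \notin SYRT sigma) =
  [|| box_col x == box_col y, box_row x == box_row y
    | (box_col x == (box_col y).+1) && (box_row x < box_row y)].
Proof.
move=> ST Tx Ty; have /SYRTP[T_std /first_columnP fcT rowT triT] := ST.
have T_inj := standard_inj T_std.
have Tx' := swap_entry Tx; have Ty' := swap_succ_entry Ty.
have Txy : T y = (T x).+1 :> nat by rewrite Tx Ty.
have Tyx' : swap i T x = (swap i T y).+1 :> nat by rewrite Tx' Ty'.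
have swap_lt u v : (u, v) != (x, y) -> (u, v) != (y, x) ->
    (swap i T u < swap i T v) = (T u < T v) by exact: swap_ltE.
apply/idP/idP; last first.
  apply: contraTN => ST'; have /SYRTP[_ /first_columnP fcT' rowT' triT'] := ST'.
  rewrite !negb_or; apply/and3P; split.
  - apply/eqP=> cxy; have [cy0|cy] := posnP (box_col y).
      have := fcT x y; have := fcT' x y; rewrite cxy cy0 => <- // /(_ erefl erefl); lia.
    have := SYRT_column ST Txy cxy cy; have := SYRT_column ST' Tyx' (esym cxy).
    by rewrite cxy => /(_ cy); lia.
  - apply/eqP=> rxy; have := rowT x y rxy; have := rowT y x (esym rxy).
    have := rowT' x y rxy; have := rowT' y x (esym rxy).
    have : box_col x <> box_col y.
      move=> cxy; have Exy := box_eq (congr1 val rxy) cxy.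
      by move: Txy; rewrite Exy; lia.
    lia.
  - apply/andP=> -[/eqP cxy rxy].
    (* The triple condition would yield a box [z] to the right of [y] whose entry is strictly
       between the consecutive entries of [y] and [x]. *)
    have lt_yx : swap i T y < swap i T x by lia.
    have [z [rz cz ltz]] := triT' y x cxy rxy lt_yx.
    have := rowT' y z (esym rz); rewrite cz ltnSn => /(_ isT); lia.
apply: contraNT; rewrite !negb_or => /and3P[cxy rxy nadj].
apply/SYRTP; split.
- exact: swap_standard.
- apply/first_columnP=> u v cu cv; rewrite -fcT // swap_lt //.
    by apply: contra_neq cxy => -[<- <-]; rewrite cu cv.
  by apply: contra_neq cxy => -[<- <-]; rewrite cu cv.
- move=> u v ruv cuv; rewrite swap_lt; first exact: rowT.
    by apply: contra_neq rxy => -[<- <-].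
  by apply: contra_neq rxy => -[<- <-].
(* For the pair [(x, y)] the premise of the triple condition is false after the swap, and [(y, x)]
   is the excluded configuration. For other pairs nothing changes: [z] and [v] share a column, while
   [x] and [y] do not. *)
move=> u v cuv ruv; have [[-> ->]|nxy] := eqVneq (u, v) (x, y); first by lia.
have [[Eu Ev]|nyx] := eqVneq (u, v) (y, x).
  by move: nadj; rewrite -Eu -Ev cuv eqxx ruv.
rewrite swap_lt // => /(triT u v cuv ruv)[z [rz cz ltz]].
exists z; split=> //; rewrite swap_lt //.
  by apply: contra_neq cxy => -[<- <-]; rewrite cz cuv.
by apply: contra_neq cxy => -[<- <-]; rewrite cz cuv.
Qed.

(** Mirror argument: rows decrease, so the left neighbour [w] is taken in the row of [u], the lower
    box, and the triple condition for [w] and [v] makes the entry of [u] exceed that of [v]. *)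
Lemma SRCT_column T u v : T \in SRCT sigma -> T v = (T u).+1 :> nat ->
  box_col u = box_col v -> 0 < box_col v -> box_row v < box_row u.
Proof.
case/SRCTP=> T_std _ rowT triT Tuv cuv cv; have T_inj := standard_inj T_std.
rewrite ltnNge; apply/negP=> le_uv.
have lt_uv : box_row u < box_row v.
  rewrite ltn_neqAle le_uv andbT; apply: contra_eqN (Tuv) => /eqP ruv.
  by rewrite (box_eq ruv cuv) neq_ltn ltnSn.
have [w rw cw] := @left_box u (box_col u).-1 (leq_pred _).
have lt_uw : T u < T w by apply: rowT; rewrite // cw; lia.
have nwv : T w != T v.
  by rewrite (inj_eq T_inj); apply: contraTneq cv => Ewu; move: cw; rewrite Ewu; lia.
have cv' : box_col v = (box_col w).+1 by lia.
have rv : box_row w < box_row v by rewrite rw.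
have lt_vw : T v < T w by rewrite ltn_neqAle val_eqE eq_sym nwv Tuv.
have [z [rz cz ltz]] := triT w v cv' rv lt_vw.
have Ezu : z = u by apply: box_eq; [rewrite rz rw | rewrite cz cw; lia].
by move: ltz; rewrite Ezu; lia.
Qed.

Lemma SRCT_swap T i x y :
    T \in SRCT sigma -> T x = entry i -> T y = succ_entry i ->
  (swap i T \notin SRCT sigma) =
  [|| box_col x == box_col y, box_row x == box_row y
    | (box_col y == (box_col x).+1) && (box_row x < box_row y)].
Proof.
move=> ST Tx Ty; have /SRCTP[T_std /first_columnP fcT rowT triT] := ST.
have T_inj := standard_inj T_std.
have Tx' := swap_entry Tx; have Ty' := swap_succ_entry Ty.
have Txy : T y = (T x).+1 :> nat by rewrite Tx Ty.
have Tyx' : swap i T x = (swap i T y).+1 :> nat by rewrite Tx' Ty'.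
have swap_lt u v : (u, v) != (x, y) -> (u, v) != (y, x) ->
    (swap i T u < swap i T v) = (T u < T v) by exact: swap_ltE.
apply/idP/idP; last first.
  apply: contraTN => ST'; have /SRCTP[_ /first_columnP fcT' rowT' triT'] := ST'.
  rewrite !negb_or; apply/and3P; split.
  - apply/eqP=> cxy; have [cy0|cy] := posnP (box_col y).
      have := fcT x y; have := fcT' x y; rewrite cxy cy0 => <- // /(_ erefl erefl); lia.
    have := SRCT_column ST Txy cxy cy; have := SRCT_column ST' Tyx' (esym cxy).
    by rewrite cxy => /(_ cy); lia.
  - apply/eqP=> rxy; have := rowT x y rxy; have := rowT y x (esym rxy).
    have := rowT' x y rxy; have := rowT' y x (esym rxy).
    have : box_col x <> box_col y.
      move=> cxy; have Exy := box_eq (congr1 val rxy) cxy.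
      by move: Txy; rewrite Exy; lia.
    lia.
  - apply/andP=> -[/eqP cxy rxy].
    have lt_yx : swap i T y < swap i T x by lia.
    have [z [rz cz ltz]] := triT' x y cxy rxy lt_yx.
    have := rowT' x z (esym rz); rewrite cz ltnSn => /(_ isT); lia.
apply: contraNT; rewrite !negb_or => /and3P[cxy rxy nadj].
apply/SRCTP; split.
- exact: swap_standard.
- apply/first_columnP=> u v cu cv; rewrite -fcT // swap_lt //.
    by apply: contra_neq cxy => -[<- <-]; rewrite cu cv.
  by apply: contra_neq cxy => -[<- <-]; rewrite cu cv.
- move=> u v ruv cuv; rewrite swap_lt; first exact: rowT.
    by apply: contra_neq rxy => -[<- <-].
  by apply: contra_neq rxy => -[<- <-].
move=> u v cuv ruv; have [[-> ->]|nyx] := eqVneq (u, v) (y, x); first by lia.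
have [[Eu Ev]|nxy] := eqVneq (u, v) (x, y).
  by move: nadj; rewrite -Eu -Ev cuv eqxx ruv.
(* The premise compares [v] with [u] in this order, so the two exceptional pairs appear reversed. *)
rewrite swap_lt; first last.
- by apply: contra_neq nxy => -[-> ->].
- by apply: contra_neq nyx => -[-> ->].
move=> /(triT u v cuv ruv)[z [rz cz ltz]].
exists z; split=> //; rewrite swap_lt //.
  by apply: contra_neq cxy => -[<- <-]; rewrite cz cuv.
by apply: contra_neq cxy => -[<- <-]; rewrite cz cuv.
Qed.

End TableauSwaps.

Theorem theorem7p8 (R : realType) (n : nat) (al : composition n)
    (sigma : 'S_(size al)) :
  [/\ @descent_compatible n (SRCT_diagram sigma) (SRCT sigma),
      is_H0_module (tab_span R (SRCT sigma)) (SRCT_action al R)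
    & forall i v, v \in tab_span R (SRCT sigma) ->
        SRCT_action al R i v
        = @diagram_action R n (SRCT_diagram sigma) (SRCT sigma) i v] /\
  [/\ @descent_compatible n (SYRT_diagram sigma) (SYRT sigma),
      is_H0_module (tab_span R (SYRT sigma)) (SYRT_action al R)
    & forall i v, v \in tab_span R (SYRT sigma) ->
        SYRT_action al R i v
        = @diagram_action R n (SYRT_diagram sigma) (SYRT sigma) i v] /\
  [/\ @descent_compatible n (SYCT_diagram sigma) (SYCT sigma),
      is_H0_module (tab_span R (SYCT sigma)) (SYCT_action al R)
    & forall i v, v \in tab_span R (SYCT sigma) ->
        SYCT_action al R i v
        = @diagram_action R n (SYCT_diagram sigma) (SYCT sigma) i v].
Proof.
have P_succ (T : filling n (comp_box al)) i x y :
    T x = entry i -> T y = succ_entry i -> T y = (T x).+1 :> nat.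
  by move=> -> ->.
split; [|split].
- apply: positional_diagram_module.
  + by move=> T /SRCTP[].
  + by move=> y x z; lia.
  + by move=> x y; lia.
  (* In a common column [i + 1] is read before [i]: the first column is read in decreasing order,
     and in the others [i + 1] is lower and reading goes upwards. *)
  + move=> T i x y ST Tx Ty; have Txy := P_succ _ _ _ _ Tx Ty.
    have /SRCTP[_ /first_columnP fcT _ _] := ST.
    have colT := SRCT_column ST Txy; have := fcT x y; rewrite /SRCT_before.
    by do !case: eqP; lia.
  + move=> T i x y ST Tx Ty ltyx; have Txy := P_succ _ _ _ _ Tx Ty.
    rewrite (SRCT_swap ST Tx Ty).
    have [rxy|//] := eqVneq (box_row x) (box_row y).
    have /SRCTP[_ _ rowT _] := ST; have := rowT x y rxy.
    by move: ltyx; rewrite /SRCT_before rxy; do !case: eqP; lia.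
- apply: positional_diagram_module.
  + by move=> T /SYRTP[].
  + by move=> y x z; lia.
  + by move=> x y; lia.
  (* Here [i] is read first in a common column, which is why [P] is a weak comparison. *)
  + move=> T i x y ST Tx Ty; have Txy := P_succ _ _ _ _ Tx Ty.
    have /SYRTP[_ /first_columnP fcT _ _] := ST.
    have colT := SYRT_column ST Txy; have := fcT x y; rewrite /SYRT_before.
    by do !case: eqP; lia.
  + move=> T i x y ST Tx Ty ltyx; have Txy := P_succ _ _ _ _ Tx Ty.
    have /SYRTP[_ /first_columnP fcT rowT _] := ST.
    rewrite (SYRT_swap ST Tx Ty).
    have lt_xy : box_col x < box_col y.
      have colT := SYRT_column ST Txy; have := fcT x y; move: ltyx; rewrite /SYRT_before.
      by do !case: eqP; lia.
    have [rxy|nrxy] := eqVneq (box_row x) (box_row y); last by lia.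
    rewrite orbT andbT; apply/esym; rewrite eqn_leq lt_xy andbT leqNgt.
    apply/negP=> lt_xy1.
    (* If [x] and [y] were not adjacent in their row, the box [w] just right of [x] would hold an
       entry strictly between [i] and [i + 1]. *)
    have [w rw cw] := left_box (ltnW lt_xy1).
    have := rowT x w; have := rowT w y; rewrite rw cw rxy.
    by move=> /(_ erefl lt_xy1) + /(_ erefl (ltnSn _)); lia.
(* The tableaux are those of [SYRT], so the same lemmas serve. Two consecutive entries of one row
   now never form a descent, since rows increase and columns are read from left to right. *)
- apply: positional_diagram_module.
  + by move=> T /SYRTP[].
  + by move=> y x z; lia.
  + by move=> x y; lia.
  + move=> T i x y ST Tx Ty; have Txy := P_succ _ _ _ _ Tx Ty.
    have /SYRTP[_ /first_columnP fcT _ _] := ST.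
    have colT := SYRT_column ST Txy; have := fcT x y; rewrite /SYCT_before.
    by do !case: eqP; lia.
  + move=> T i x y ST Tx Ty ltyx; have Txy := P_succ _ _ _ _ Tx Ty.
    rewrite (SYRT_swap ST Tx Ty).
    have [rxy|//] := eqVneq (box_row x) (box_row y).
    have /SYRTP[_ _ rowT _] := ST; have := rowT x y rxy; have := rowT y x (esym rxy).
    by move: ltyx; rewrite /SYCT_before rxy; do !case: eqP; lia.
Qed.
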